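(* Let $v\in(0,1)$ and $b\in\mathbb{N}_0$, and assume $E[C_1]<\infty$. The expected discounted bailouts (capital injections) $V_B^b(x):=E_x^{[0,b]}\sum_{l=0}^\infty v^lr_*(l)$ of the process doubly reflected at $0$ and $b$ satisfy, for $x\in\mathbb{Z}$, $$V_B^b(x)=\begin{cases}Z_v(x)\,\dfrac{\Delta Z_{1,v}(b)}{\Delta Z_v(b)}-Z_{1,v}(x), & x\le b,\\[2mm] V_B^b(b), & x>b.\end{cases}$$
   Context: Notation: $\mathbb{N}=\{1,2,\dots\}$, $\mathbb{N}_0=\{0,1,2,\dots\}$; $E[Y;A]:=E[Y\mathbf{1}_A]$; $\inf\emptyset=\infty$; $\Delta f(k):=f(k+1)-f(k)$ for $k\in\mathbb{N}_0$. Let $(p_k)_{k\in\mathbb{N}_0}$ be a probability mass function on $\mathbb{N}_0$ with $p_0>0$, and let $C_1,C_2,\dots$ be i.i.d. with $P(C_1=k)=p_k$. Let $X_n=X_0+n-\sum_{i=1}^nC_i$, $n\in\mathbb{N}_0$; for $x\in\mathbb{Z}$, $P_x$ (expectation $E_x$) is the law under which $X_0=x$, and $P=P_0$, $E=E_0$. For $b\in\mathbb{Z}$ let $\tau_b^-=\inf\{n\in\mathbb{N}_0:X_n\le b\}$ and $\tau_b^+=\inf\{n\in\mathbb{N}_0:X_n\ge b\}$. For $v\in(0,1]$: $W_v(y):=\big(p_0E[v^{\tau_y^+};\tau_y^+<\tau_{-1}^-]\big)^{-1}$ for $y\in\mathbb{N}_0$, and $W_v(y):=0$ for integers $y<0$.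 For $v,w\in(0,1]$ and $x\in\mathbb{Z}$: $\Psi_v(x,w):=E_x[v^{\tau_{-1}^-}w^{-X(\tau_{-1}^-)};\tau_{-1}^-<\infty]$ and $Z_v(x,w):=\Psi_v(x,w)+\alpha_v(w)W_v(x)$, where the constant $\alpha_v(w)\in[0,\infty)$ is chosen so that $Z_v(0,w)=1$. Further $Z_v(x):=Z_v(x,1)$ and, when $E[C_1]<\infty$, $Z_{1,v}(x):=-\frac{\partial Z_v(x,w)}{\partial w}\big|_{w=1-}$ (left derivative at $w=1$). Doubly reflected surplus process: fix $b\in\mathbb{N}_0$ and initial capital $x\in\mathbb{Z}$. At time $0$ capital $r_*(0)=\max(-x,0)$ is injected and the dividend $r(0)=\max(x-b,0)$ is paid, so the surplus is $\tilde X_0=x+r_*(0)-r(0)$. In period $l\in\mathbb{N}$, put $y_l=\tilde X_{l-1}+1-C_l$; at the end of the period capital $r_*(l)=\max(-y_l,0)$ is injected and dividend $r(l)=\max(y_l-b,0)$ is paid, so $\tilde X_l=y_l+r_*(l)-r(l)$. $E_x^{[0,b]}$ denotes expectation for this process with initial capital $x$. *)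

(* Defs.v *)
From HB Require Import structures.
From mathcomp Require Import all_boot all_order all_algebra.
From mathcomp Require Import all_classical all_reals all_analysis.

Set Implicit Arguments.
Unset Strict Implicit.
Unset Printing Implicit Defensive.

Import Order.TTheory GRing.Theory Num.Theory.
Import numFieldNormedType.Exports.

Local Open Scope classical_set_scope.
Local Open Scope ring_scope.

(** * Claim distribution and i.i.d. claims *)

Definition is_pmf (R : realType) (p : nat -> R) : Prop :=
  (forall k, 0 <= p k) /\ (\sum_(0 <= k <oo) (p k)%:E = 1)%E.

Definition mutually_independent d (T : measurableType d) (R : realType)
    (P : probability T R) d' (T' : measurableType d') (X : nat -> T -> T') :
    Prop :=
  forall (J : seq nat) (A : nat -> set T'),
    uniq J -> (forall i, measurable (A i)) ->
    (P (\bigcap_(i in [set` J]) (X i @^-1` A i)) =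
     \prod_(i <- J) P (X i @^-1` A i))%E.

(** The claims [C_1, C_2, ...] are indexed from [0]: [C i] is [C_{i+1}]. *)
Definition iid_claims d (T : measurableType d) (R : realType)
    (P : probability T R) (p : nat -> R) (C : nat -> {RV P >-> nat}) : Prop :=
  mutually_independent P (fun i => C i : T -> nat) /\
  (forall i k, P (C i @^-1` [set k]) = (p k)%:E).

(** * Random times with values in [nat] together with infinity ([None]) *)

Definition first_time (A : pred nat) : option nat :=
  if pselect (exists n, A n) is left exA then Some (ex_minn exA) else None.

Definition time_lt (s t : option nat) : bool :=
  match s, t with
  | Some m, Some n => (m < n)%N
  | Some _, None => true
  | None, _ => false
  end.

(** [v ^ t]; the value at infinity is never used, as every expectation below
    is restricted to an event on which the time is finite. *)
Definition discount (R : realType) (v : R) (t : option nat) : R :=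
  if t is Some n then v ^+ n else 0.

(** [X(t)], with the same remark about [t] infinite. *)
Definition at_time (X : nat -> int) (t : option nat) : int :=
  if t is Some n then X n else 0.

(** [E[Y; A]] *)
Definition expect_on d (T : measurableType d) (R : realType)
    (P : probability T R) (Y : T -> R) (A : set T) : \bar R :=
  'E_P[fun t => Y t * \1_A t].

(** * The random walk and its scale functions

    A single probability space carries all starting points: the law of the walk
    under [P_x] is that of [walk C x] under [P]. *)

Definition walk (T : Type) (C : nat -> T -> nat) (x : int) (t : T) (n : nat) :
    int :=
  x + n%:Z - \sum_(i < n) (C i t)%:Z.

Definition tau_minus (T : Type) (C : nat -> T -> nat) (x b : int) (t : T) :
    option nat :=
  first_time (fun n => walk C x t n <= b).

Definition tau_plus (T : Type) (C : nat -> T -> nat) (x b : int) (t : T) :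
    option nat :=
  first_time (fun n => b <= walk C x t n).

Section ScaleFunctions.
Context d (T : measurableType d) (R : realType) (P : probability T R).
Context (p : nat -> R) (C : nat -> T -> nat).

Definition W (v : R) (y : int) : R :=
  if y < 0 then 0 else
  (p 0%N * fine (expect_on P (fun t => discount v (tau_plus C 0 y t))
     [set t | time_lt (tau_plus C 0 y t) (tau_minus C 0 (-1) t)]))^-1.

(** [w ^ m] with [m : int] is the integer power. *)
Definition Psi (v : R) (x : int) (w : R) : R :=
  fine (expect_on P
    (fun t => discount v (tau_minus C x (-1) t) *
              w ^ (- at_time (walk C x t) (tau_minus C x (-1) t)))
    [set t | tau_minus C x (-1) t <> None]).

(** The solution of [Psi v 0 w + alpha v w * W v 0 = 1]; see [Zw0] and
    [alpha_ge0] below. *)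
Definition alpha (v w : R) : R := (1 - Psi v 0 w) / W v 0.

Definition Zw (v : R) (x : int) (w : R) : R :=
  Psi v x w + alpha v w * W v x.

Definition Z (v : R) (x : int) : R := Zw v x 1.

(** Minus the left derivative of [Zw v x] at [1]. *)
Definition Z1 (v : R) (x : int) : R :=
  - lim ((fun w => (Zw v x w - Zw v x 1) / (w - 1)) @ 1^'-).

End ScaleFunctions.

Definition fwd_diff (R : realType) (f : int -> R) (k : nat) : R :=
  f k.+1%:Z - f k%:Z.

(** * The doubly reflected surplus process *)

Definition injection (y : int) : int := Num.max (- y) 0.

Definition dividend (b : nat) (y : int) : int := Num.max (y - b%:Z) 0.

(** Capital just before the injection and the dividend of period [l]: the
    initial capital [x] for [l = 0], and [y_l] for [l >= 1]. *)
Fixpoint pre_surplus (T : Type) (C : nat -> T -> nat) (b : nat) (x : int)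
    (t : T) (l : nat) : int :=
  if l is m.+1 then
    let y := pre_surplus C b x t m in
    (y + injection y - dividend b y) + 1 - (C m t)%:Z
  else x.

(** [r_*(l)] *)
Definition bailout (T : Type) (C : nat -> T -> nat) (b : nat) (x : int)
    (t : T) (l : nat) : int :=
  injection (pre_surplus C b x t l).

(** The value is an extended real: its finiteness is not presupposed. *)
Definition V_B d (T : measurableType d) (R : realType) (P : probability T R)
    (C : nat -> T -> nat) (v : R) (b : nat) (x : int) : \bar R :=
  (\int[P]_t \sum_(0 <= l <oo) (v ^+ l * (bailout C b x t l)%:~R)%:E)%E.

(** * The normalisation of [Zw] *)

Lemma first_time0 (A : pred nat) : A 0%N -> first_time A = Some 0%N.
Proof.
move=> A0; rewrite /first_time; case: pselect => [h|[]]; last by exists 0%N.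
by case: ex_minnP => m _ /(_ _ A0); rewrite leqn0 => /eqP ->.
Qed.

Lemma first_timeP (A : pred nat) n : first_time A = Some n -> A n.
Proof.
rewrite /first_time; case: pselect => // h [<-].
by case: ex_minnP.
Qed.

Lemma walk0 (T : Type) (C : nat -> T -> nat) x t : walk C x t 0 = x.
Proof. by rewrite /walk big_ord0 addr0 subr0. Qed.

Section Normalisation.
Context d (T : measurableType d) (R : realType) (P : probability T R).
Context (p : nat -> R) (C : nat -> T -> nat).

Lemma W0 v : W P p C v 0 = (p 0%N)^-1.
Proof.
rewrite /W ltxx /expect_on.
rewrite (_ : (fun t => _) = (cst 1 : T -> R)) ?expectation_cst ?mulr1 //.
apply/funext => t /=.
have tau0 : tau_plus C 0 0 t = Some 0%N.
  by apply: first_time0; rewrite walk0.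
rewrite tau0 /= expr0 mul1r indicE mem_set //= tau0.
case E: (tau_minus C 0 (-1) t) => [[|n]|] //.
by move/first_timeP: E; rewrite walk0.
Qed.

Lemma Zw0 v w : 0 < p 0%N -> Zw P p C v 0 w = 1.
Proof.
move=> p0; rewrite /Zw /alpha divfK ?subrKC //.
by rewrite W0 invr_eq0 gt_eqF.
Qed.

Lemma expect_on_le1 (Y : T -> R) (A : set T) :
  (forall t, A t -> 0 <= Y t <= 1) -> fine (expect_on P Y A) <= 1.
Proof.
move=> Y01.
have YA t : 0 <= Y t * \1_A t <= 1.
  rewrite indicE; have [/set_mem/Y01 H|_] := boolP (t \in A).
    by rewrite mulr1.
  by rewrite mulr0 lexx ler01.
suff : (0 <= expect_on P Y A <= 1)%E.
  by case: (expect_on P Y A) => [r| |] //=; rewrite ?lee_fin => /andP[].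
rewrite /expect_on unlock; apply/andP; split.
  by apply: integral_ge0 => t _; rewrite lee_fin; case/andP: (YA t).
rewrite ge0_integralTE; last first.
  by move=> t; rewrite lee_fin; case/andP: (YA t).
apply: (@le_trans _ _ (\int[P]_t (cst 1%E t))%E); last first.
  by rewrite integral_cst //= probability_setT mule1.
rewrite [leRHS]ge0_integralTE //; apply: ereal_sup_le => _ [h hY <-].
exists h => // t.
apply: le_trans (hY t) _.
by rewrite lee_fin; case/andP: (YA t).
Qed.

Lemma alpha_ge0 v w :
  0 < p 0%N -> 0 < v <= 1 -> 0 < w <= 1 -> 0 <= alpha P p C v w.
Proof.
move=> p0 /andP[v0 v1] /andP[w0 w1]; rewrite /alpha W0 invrK.
rewrite mulr_ge0 ?(ltW p0) // subr_ge0; apply: expect_on_le1 => t /=.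
case E: (tau_minus C 0 (-1) t) => [n|] // _ /=.
move/first_timeP: E => Xn.
case: (walk C 0 t n) Xn => // k _; rewrite NegzE opprK -exprnP.
apply/andP; split; first by rewrite mulr_ge0 ?exprn_ge0 // ltW.
by apply: mulr_ile1; rewrite ?exprn_ge0 ?exprn_ile1 // ltW.
Qed.

End Normalisation.

(* Main.v *)
Require Import Defs.
From HB Require Import structures.
From mathcomp Require Import all_boot all_order all_algebra.
From mathcomp Require Import all_classical all_reals all_analysis.
From mathcomp Require Import measurable_realfun.
From mathcomp Require Import zify ring.

Set Implicit Arguments.
Unset Strict Implicit.
Unset Printing Implicit Defensive.

Import Order.TTheory GRing.Theory Num.Theory.
Import numFieldNormedType.Exports.

Local Open Scope classical_set_scope.
Local Open Scope ring_scope.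

(** Write A f(x) = E f(x + 1 - C_1) for the mean of a function f of the capital
    after one period of the walk.  Everything rests on one observation: on a
    stretch of states where f = v A f, the values of f propagate upwards, because
    x + 1 - C_1 exceeds x only when C_1 = 0, and that has the positive
    probability p_0.  Thus f is determined on x <= n by its values on x <= 0 as
    soon as it is [harmonic] on 0 <= x < n ([harmonic_unique]).

    Conditioning on the first claim makes each quantity in play harmonic.  To
    treat them uniformly, consider rewards c(x) collected in successive states
    x, multiplied by m(x) at each passage and driven by x := S(x, claim); their
    expected total is [value], which satisfies the first-step equation
    [value_step].  Independence enters there only, through the probabilities of
    cylinders ([integral_cylinder_payoff]).
    - Rewards collected at a first exit time give Psi_v(., w), its derivative
      in w, and the mean discount factor h_y(x) of a climb from x to y before
      ruin.  By uniqueness h_y(x) and h_z(x) are proportional in x up to the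
      smaller level, so that W_v(x) = h_y(x) / (p_0 h_y(0)) for all x <= y and
      W_v inherits harmonicity ([W_harmonic]).
    - Hence Z_v is harmonic on x >= 0 and equals 1 on x <= 0.  Differentiating
      under the expectation ([Psi_slope_cvg]) writes Z_{1,v} as a combination of
      the mean discounted deficit at ruin and of W_v, so it is harmonic on
      x >= 0 too, and Z_{1,v}(x) = x on x <= 0.
    - Injections discounted by v give V_B, which is harmonic on 0 <= x <= b,
      equals V_B(0) - x on x <= 0, and is constant on x >= b.

    Now V_B + Z_{1,v} and V_B(0) Z_v agree on x <= 0 and are harmonic on
    0 <= x <= b, so they agree on x <= b + 1 ([mean_bailouts_scale]).  Taking
    the difference of this identity at b + 1 and b removes V_B, and
    Delta Z_v(b) > 0 ([Z_fwd_diff_gt0], where v < 1 matters) yields V_B(0). *)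

(** * Integrals over a random index *)
Section Selection.
Context d (T : measurableType d) (R : realType) (N : T -> nat).
Hypothesis mN : measurable_fun setT N.

Lemma measurable_level k : measurable (N @^-1` [set k]).
Proof. by rewrite -[X in measurable X]setTI; exact: mN. Qed.

Lemma measurable_select (f : nat -> T -> \bar R) :
  (forall k, measurable_fun setT (f k)) ->
  measurable_fun setT (fun t => f (N t) t).
Proof.
move=> mf _ Y mY; rewrite setTI.
rewrite (_ : _ @^-1` _ = \bigcup_k (N @^-1` [set k] `&` (f k @^-1` Y))).
  apply: bigcupT_measurable => k.
  apply: measurableI; first exact: measurable_level.
  by rewrite -[X in measurable X]setTI; exact: mf.
apply/seteqP; split => [t Yt|t [k _ [/= <-]]] //.
by exists (N t).
Qed.

Lemma integral_select (mu : {measure set T -> \bar R}) (D : set T)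
    (f : nat -> T -> \bar R) :
  measurable D -> (forall k, measurable_fun setT (f k)) ->
  (forall k t, 0 <= f k t)%E ->
  (\int[mu]_(t in D) f (N t) t =
   \sum_(0 <= k <oo) \int[mu]_(t in D `&` N @^-1` [set k]) f k t)%E.
Proof.
move=> mD mf f0.
have DE : D = \bigcup_k (D `&` N @^-1` [set k]).
  by apply/seteqP; split => [t Dt|t [k _ []] //]; exists (N t).
rewrite [in LHS]DE ge0_integral_bigcup //=.
- apply: eq_eseriesr => k _; apply: eq_integral => t.
  by rewrite inE => -[_ /= ->].
- by move=> k; apply: measurableI => //; exact: measurable_level.
- by rewrite -DE; apply: measurable_funTS; exact: measurable_select.
- apply/trivIsetP => i j _ _ ij; apply/seteqP; split => // t /= [[_ ti] [_ tj]].
  by move/eqP: ij; apply; rewrite -ti -tj.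
Qed.

End Selection.

Arguments measurable_select {d T R N} mN {f}.
Arguments integral_select {d T R N} mN {mu D f}.

(** * Discounted rewards driven by i.i.d. claims *)
Section DiscountedChain.
Context (R : realType) (c m : int -> R) (S : int -> nat -> int).

(** The reward of period [n] when the claims are [w]: the recursion consumes the
    first claim, which is what makes conditioning on it immediate. *)
Fixpoint payoff (n : nat) (x : int) (w : nat -> nat) : R :=
  if n is n'.+1 then m x * payoff n' (S x (w 0%N)) (fun i => w i.+1) else c x.

Context d (T : measurableType d) (P : probability T R).
Context (p : nat -> R) (C : nat -> T -> nat).

(** The expectation of [payoff n x] computed one period at a time, as if the
    remaining claims were a fresh copy of the sequence; that this is legitimate
    is [integral_payoff]. *)
Fixpoint mean_payoff (n : nat) (x : int) : \bar R :=
  if n is n'.+1 then ((m x)%:E * \int[P]_t mean_payoff n' (S x (C 0%N t)))%E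
  else (c x)%:E.

Definition value (x : int) : \bar R := (\sum_(0 <= n <oo) mean_payoff n x)%E.

Definition claims_from (j : nat) (t : T) : nat -> nat := fun i => C (j + i)%N t.

Definition cylinder (s : seq nat) : set T :=
  [set t | forall i, (i < size s)%N -> C i t = nth 0%N s i].

Hypothesis (c0 : forall x, 0 <= c x) (m0 : forall x, 0 <= m x).
Hypothesis mC : forall i, measurable_fun setT (C i).
Hypothesis indC : mutually_independent P C.
Hypothesis lawC : forall i k, P (C i @^-1` [set k]) = (p k)%:E.

Lemma cylinderE s : cylinder s =
  \bigcap_(i in [set` iota 0 (size s)]) (C i @^-1` [set nth 0%N s i]).
Proof.
apply/seteqP; split => [t h i /=|t h i si].
  by rewrite mem_iota /= => si; exact: h.
by apply: h => /=; rewrite mem_iota.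
Qed.

Lemma cylinder_rcons s k :
  cylinder (rcons s k) = cylinder s `&` C (size s) @^-1` [set k].
Proof.
apply/seteqP; split => [t h|t [h /= tk] i].
  split => [i si|/=].
    by have := h i; rewrite size_rcons nth_rcons si leqW // => ->.
  by have := h (size s); rewrite size_rcons nth_rcons ltnn eqxx ltnSn => ->.
rewrite size_rcons nth_rcons ltnS leq_eqVlt => /predU1P[->|si].
  by rewrite ltnn eqxx.
by rewrite si; exact: h.
Qed.

Lemma measurable_cylinder s : measurable (cylinder s).
Proof.
elim/last_ind: s => [|s k ih].
  by rewrite (_ : cylinder [::] = setT) //; apply/seteqP; split.
rewrite cylinder_rcons; apply: measurableI => //.
exact/measurable_level/mC.
Qed.

Lemma prob_cylinder s :
  P (cylinder s) = (\prod_(i < size s) p (nth 0%N s i))%:E.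
Proof.
have mA i : measurable [set nth 0%N s i] by [].
rewrite cylinderE (indC (iota_uniq 0 (size s)) mA).
rewrite -(big_mkord xpredT (fun i => p (nth 0%N s i))) /index_iota subn0.
by rewrite (eq_bigr (fun i => (p (nth 0%N s i))%:E)) ?prodEFin.
Qed.

Lemma prob_cylinder_rcons s k :
  P (cylinder (rcons s k)) = (P (cylinder s) * (p k)%:E)%E.
Proof.
rewrite !prob_cylinder size_rcons big_ord_recr /= -EFinM; congr (_ * _)%:E.
  by apply: eq_bigr => i _; rewrite nth_rcons ltn_ord.
by rewrite nth_rcons ltnn eqxx.
Qed.

Lemma payoff_ge0 n x w : 0 <= payoff n x w.
Proof. by elim: n x w => //= n ih x w; rewrite mulr_ge0. Qed.

Lemma mean_payoff_ge0 n x : (0 <= mean_payoff n x)%E.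
Proof.
elim: n x => [|n ih] x /=; first by rewrite lee_fin.
by rewrite mule_ge0 ?lee_fin //; apply: integral_ge0.
Qed.

Lemma payoff_claims_fromS n x j t :
  payoff n.+1 x (claims_from j t) =
  m x * payoff n (S x (C j t)) (claims_from j.+1 t).
Proof.
rewrite /= /claims_from addn0; congr (_ * payoff _ _ _).
by apply/funext => i; rewrite addnS.
Qed.

Lemma measurable_payoff n x j :
  measurable_fun setT (fun t => (payoff n x (claims_from j t))%:E).
Proof.
elim: n x j => [|n ih] x j; first by rewrite /=; exact: measurable_cst.
under eq_fun do rewrite payoff_claims_fromS EFinM.
apply: measurable_funeM.
by apply: (measurable_select (mC j)
  (f := fun k t => (payoff n (S x k) (claims_from j.+1 t))%:E)).
Qed.

Lemma measurable_claim_fun (f : nat -> \bar R) j :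
  measurable_fun setT (fun t => f (C j t)).
Proof.
apply: (measurable_select (mC j) (f := fun k _ => f k)) => k.
exact: measurable_cst.
Qed.

Lemma integral_claim0 (f : nat -> \bar R) : (forall k, 0 <= f k)%E ->
  (\int[P]_t f (C 0%N t) = \sum_(0 <= k <oo) (p k)%:E * f k)%E.
Proof.
move=> f0; rewrite (integral_select (mC 0) (f := fun k _ => f k)) //.
apply: eq_eseriesr => k _; rewrite setTI integral_cst //.
  by rewrite muleC; congr (_ * _)%E; exact: lawC.
exact/measurable_level/mC.
Qed.

(** The claims after the first [size s] ones are independent of the event
    [cylinder s] and distributed as the whole sequence.  Keeping [s] arbitrary
    lets the induction on [n] absorb each new claim into the conditioning event,
    so only the probabilities of cylinders are needed and no law on the space of
    claim sequences. *)
Lemma integral_cylinder_payoff n x s :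
  (\int[P]_(t in cylinder s) (payoff n x (claims_from (size s) t))%:E =
   P (cylinder s) * mean_payoff n x)%E.
Proof.
elim: n x s => [|n ih] x s.
  transitivity (\int[P]_(t in cylinder s) (cst (c x)%:E t))%E.
    by apply: eq_integral.
  by rewrite (integral_cst _ (measurable_cylinder s)); exact: muleC.
have mcyl := @measurable_cylinder.
have pge0 k : 0 <= p k by rewrite -lee_fin -(lawC 0%N k).
rewrite [mean_payoff _ _]/=.
rewrite (integral_claim0 (f := fun k => mean_payoff n (S x k))); last first.
  by move=> k; exact: mean_payoff_ge0.
pose F k t := (payoff n (S x k) (claims_from (size s).+1 t))%:E.
have mF k : measurable_fun setT (F k) by exact: measurable_payoff.
under eq_integral do rewrite payoff_claims_fromS EFinM.
rewrite ge0_integralZl //=; last 3 first.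
- by apply: measurable_funTS; exact: (measurable_select (mC _) mF).
- by move=> t _; rewrite lee_fin payoff_ge0.
- by rewrite lee_fin.
rewrite muleCA; congr (_ * _)%E.
rewrite (integral_select (mC _) (f := F)) //.
- rewrite prob_cylinder -nneseriesZl; last first.
    by move=> k _; rewrite mule_ge0 ?lee_fin // mean_payoff_ge0.
  apply: eq_eseriesr => k _; rewrite -cylinder_rcons.
  have := ih (S x k) (rcons s k); rewrite size_rcons => ->.
  by rewrite prob_cylinder_rcons prob_cylinder muleA.
- by move=> k t; rewrite lee_fin payoff_ge0.
Qed.

Lemma integral_payoff n x :
  (\int[P]_t (payoff n x (fun i => C i t))%:E = mean_payoff n x)%E.
Proof.
have := integral_cylinder_payoff n x [::].
rewrite (_ : cylinder [::] = setT); last by apply/seteqP; split.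
by rewrite probability_setT mul1e.
Qed.

Lemma valueE x :
  (\int[P]_t \sum_(0 <= n <oo) (payoff n x (fun i => C i t))%:E = value x)%E.
Proof.
rewrite integral_nneseries //.
- by apply: eq_eseriesr => n _; exact: integral_payoff.
- by move=> n; exact: (measurable_payoff n x 0).
- by move=> n t _; rewrite lee_fin payoff_ge0.
Qed.

Lemma value_ge0 x : (0 <= value x)%E.
Proof. by apply: nneseries_ge0 => n _ _; exact: mean_payoff_ge0. Qed.

(** Shift of the series: every period but the first starts after the first
    claim. *)
Lemma value_step x :
  (value x = (c x)%:E + (m x)%:E * \int[P]_t value (S x (C 0%N t)))%E.
Proof.
have mp0 := mean_payoff_ge0.
rewrite /value nneseries_recl //; congr (_ + _)%E.
rewrite -nneseries_addn // integral_nneseries //; last first.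
  by move=> n; exact: (measurable_claim_fun (fun k => mean_payoff n (S x k))).
rewrite -nneseriesZl; last by move=> n _; apply: integral_ge0.
by apply: eq_eseriesr => n _; rewrite addn1.
Qed.

(** A supersolution of the first-step equation dominates every partial sum of
    the value, by induction on the number of periods. *)
Lemma value_le (f : int -> \bar R) :
  (forall x, (c x)%:E + (m x)%:E * \int[P]_t f (S x (C 0%N t)) <= f x)%E ->
  (forall x, 0 <= f x)%E -> forall x, (value x <= f x)%E.
Proof.
move=> sf f0 x.
suff sum_le n y : (\sum_(0 <= k < n) mean_payoff k y <= f y)%E.
  apply: lime_le; first by apply: is_cvg_nneseries => n _ _; exact: mean_payoff_ge0.
  by apply: nearW => n.
elim: n y => [|n ih] y; first by rewrite big_geq.
have mp0 := mean_payoff_ge0.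
apply: le_trans (sf y).
rewrite big_nat_recl //= leeD2l //.
rewrite -ge0_sume_distrr; last by move=> k _; apply: integral_ge0.
rewrite lee_wpmul2l ?lee_fin //.
rewrite -ge0_integral_sum //; last first.
  by move=> k; exact: (measurable_claim_fun (fun j => mean_payoff k (S y j))).
apply: ge0_le_integral => //.
- by move=> t _; apply: sume_ge0.
- exact: (measurable_claim_fun
    (fun j => \sum_(0 <= k < n) mean_payoff k (S y j))%E).
- exact: (measurable_claim_fun (fun j => f (S y j))).
Qed.

End DiscountedChain.

(** * Harmonic functions of the walk *)
Section Harmonic.
Context (R : realType) d (T : measurableType d) (P : probability T R).
Context (p : nat -> R) (C : nat -> T -> nat).
Hypothesis mC : forall i, measurable_fun setT (C i).
Hypothesis indC : mutually_independent P C.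
Hypothesis lawC : forall i k, P (C i @^-1` [set k]) = (p k)%:E.
Hypothesis p0_gt0 : 0 < p 0%N.
Hypothesis intC : P.-integrable setT (fun t => (C 0%N t)%:R%:E).

Definition next_mean (f : int -> R) (x : int) : R :=
  \int[P]_t f (x + 1 - (C 0%N t)%:Z).

Definition next_integrable (f : int -> R) : Prop :=
  forall x, P.-integrable setT (fun t => (f (x + 1 - (C 0%N t)%:Z))%:E).

Definition shortfall (x : int) : R := (injection x)%:~R.

Lemma shortfall_ge0 x : 0 <= shortfall x.
Proof. by rewrite /shortfall ler0z /injection; lia. Qed.

Lemma shortfall_le0 x : x <= 0 -> shortfall x = - x%:~R.
Proof.
by move=> x0; rewrite /shortfall -mulrNz; congr (_ %:~R); rewrite /injection; lia.
Qed.

Lemma shortfall_nonneg x : 0 <= x -> shortfall x = 0.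
Proof.
move=> x0; rewrite /shortfall (_ : injection x = 0) //.
by rewrite /injection; lia.
Qed.

Lemma shortfall_le_nat x k : - x <= k%:Z -> shortfall x <= k%:R.
Proof.
by move=> xk; rewrite /shortfall -[k%:R]/(k%:Z%:~R) ler_int /injection; lia.
Qed.

Lemma measurable_claim_EFin (f : nat -> R) j :
  measurable_fun setT (fun t => (f (C j t))%:E).
Proof. exact: (measurable_claim_fun mC (fun k => (f k)%:E)). Qed.

Lemma integrable_cstT (a : R) : P.-integrable setT (fun=> a%:E).
Proof. exact: finite_measure_integrable_cst. Qed.

Lemma integral_cstT (a : R) : (\int[P]_t a%:E = a%:E)%E.
Proof.
rewrite (integral_cst P measurableT).
by rewrite -[RHS]mule1; congr (_ * _)%E; exact: probability_setT.
Qed.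

Lemma integrable_claimD (a : R) :
  P.-integrable setT (fun t => ((C 0%N t)%:R + a)%:E).
Proof.
rewrite (_ : (fun t => _) = (fun t => (C 0%N t)%:R%:E) \+ (fun=> a%:E)) //.
by apply: integrableD => //; exact: integrable_cstT.
Qed.

(** The walk rises by at most one per period and falls by at most the claim,
    whose mean is finite. *)
Lemma growth_next_integrable (L : R) f :
  (forall x, `|f x| <= shortfall x + L) -> next_integrable f.
Proof.
move=> fL x; apply: (le_integrable _ _ _ (integrable_claimD (`|x|%:~R + `|L|))) => //.
  exact: (measurable_claim_EFin (fun k => f (x + 1 - k%:Z))).
move=> t _; rewrite lee_fin (le_trans (fL _)) // [leRHS]ger0_norm.
  rewrite addrA lerD ?ler_norm //.
  rewrite -[(C 0%N t)%:R]/((C 0%N t)%:Z%:~R) -intrD /shortfall ler_int /injection.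
  lia.
by rewrite !addr_ge0 // ler0z.
Qed.

Lemma next_integrableD f g :
  next_integrable f -> next_integrable g -> next_integrable (fun x => f x + g x).
Proof.
move=> intf intg x.
exact: (integrableD measurableT (intf x) (intg x)).
Qed.

Lemma next_integrableZ a f :
  next_integrable f -> next_integrable (fun x => a * f x).
Proof. by move=> intf x; exact: (integrableZl measurableT a (intf x)). Qed.

Lemma next_meanD f g x : next_integrable f -> next_integrable g ->
  next_mean (fun y => f y + g y) x = next_mean f x + next_mean g x.
Proof.
move=> intf intg.
by rewrite /next_mean RintegralD //; [exact: intf|exact: intg].
Qed.

Lemma next_meanZ a f x : next_integrable f ->
  next_mean (fun y => a * f y) x = a * next_mean f x.
Proof. by move=> intf; rewrite /next_mean RintegralZl //; exact: intf. Qed.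

Lemma eq_next_mean f g x : (forall y, y <= x + 1 -> f y = g y) ->
  next_mean f x = next_mean g x.
Proof. by move=> fg; apply: eq_Rintegral => t _; apply: fg; lia. Qed.

(** Among the states that can follow [x], the top one [x + 1] is reached exactly
    when there is no claim. *)
Lemma next_mean_atom (a e : R) x :
  next_mean (fun y => a + e * (y == x + 1)%:R) x = a + p 0%N * e.
Proof.
have mE : measurable (C 0%N @^-1` [set 0%N]) by exact: measurable_level (mC 0) 0%N.
rewrite /next_mean /Rintegral.
rewrite (_ : (fun t => _) =
    (fun t => a%:E + e%:E * (\1_(C 0%N @^-1` [set 0%N]) t)%:E)%E); last first.
  apply/funext => t; rewrite EFinD EFinM indicE; congr (_ + _ * _%:R%:E)%E.
  rewrite [in RHS](_ : _ \in _ = (C 0%N t == 0%N)); first by congr nat_of_bool; lia.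
  by apply/idP/eqP; rewrite inE.
have intI : P.-integrable setT (fun t => (\1_(C 0%N @^-1` [set 0%N]) t)%:E : \bar R).
  exact: integrable_indic.
rewrite integralD //=; last 2 first.
- exact: integrable_cstT.
- exact: (integrableZl measurableT e intI).
rewrite integralZl // integral_indic // setIT.
transitivity (fine (a%:E + e%:E * (p 0%N)%:E)%E); last by rewrite /= mulrC.
by congr fine; congr (_ + _ * _)%E; [exact: integral_cstT|exact: lawC].
Qed.

Definition harmonic (v : R) (f : int -> R) (x : int) : Prop :=
  f x = v * next_mean f x.

Lemma harmonicD v f g x : next_integrable f -> next_integrable g ->
  harmonic v f x -> harmonic v g x -> harmonic v (fun y => f y + g y) x.
Proof.
by move=> intf intg hf hg; rewrite /harmonic next_meanD // mulrDr -hf -hg.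
Qed.

Lemma harmonicZ v a f x : next_integrable f ->
  harmonic v f x -> harmonic v (fun y => a * f y) x.
Proof. by move=> intf hf; rewrite /harmonic next_meanZ // mulrCA -hf. Qed.

Lemma eq_harmonic v f g x : (forall y, y <= x + 1 -> f y = g y) ->
  harmonic v f x -> harmonic v g x.
Proof.
by move=> fg; rewrite /harmonic (eq_next_mean fg) fg //; lia.
Qed.

(** If the difference [u] of two solutions vanishes up to [n], its mean after one
    period from [n] is [p 0 * u (n + 1)], which harmonicity at [n] makes zero. *)
Lemma harmonic_unique (v : R) f g (n : nat) : 0 < v ->
  next_integrable f -> next_integrable g ->
  (forall x, x <= 0 -> f x = g x) ->
  (forall x, 0 <= x < n%:Z -> harmonic v f x) ->
  (forall x, 0 <= x < n%:Z -> harmonic v g x) ->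
  forall x, x <= n%:Z -> f x = g x.
Proof.
move=> v0 intf intg fg hf hg.
elim: n hf hg => [|n ih] hf hg x xn; first exact: fg.
have {}ih y : y <= n%:Z -> f y = g y.
  by apply: ih => z zn; [apply: hf|apply: hg]; lia.
have [xn'|nx] := leP x n%:Z; first exact: ih.
have -> : x = n%:Z + 1 by lia.
set u := fun y => f y + (-1) * g y.
have intNg := next_integrableZ (-1) intg.
have u0 y : y <= n%:Z -> u y = 0 by move=> yn; rewrite /u ih // mulN1r subrr.
have hu : harmonic v u n%:Z.
  by apply: harmonicD => //; [apply: hf|apply: harmonicZ => //; apply: hg]; lia.
move: hu; rewrite /harmonic u0 //.
rewrite (@eq_next_mean _ (fun y => 0 + u (n%:Z + 1) * (y == n%:Z + 1)%:R)); last first.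
  move=> y; rewrite le_eqVlt => /predU1P[->|yn]; first by rewrite eqxx mulr1 add0r.
  by rewrite u0 ?lt_eqF // ?mulr0 ?addr0 //; lia.
rewrite next_mean_atom add0r => /esym/eqP.
rewrite !mulf_eq0 (gt_eqF v0) (gt_eqF p0_gt0) /=.
by rewrite /u mulN1r subr_eq0 => /eqP.
Qed.

(** * Values bounded by the shortfall *)
Section Bound.
Context (v : R).
Hypothesis v01 : 0 < v < 1.

Definition mean_claim : R := \int[P]_t (C 0%N t)%:R.

(** The fixed point of [L = 1 + v * (mean_claim + L)] ([excessE]), which is what
    makes [shortfall + excess] a supersolution in [value_bound]. *)
Definition excess : R := (1 + v * mean_claim) / (1 - v).

Lemma mean_claim_ge0 : 0 <= mean_claim.
Proof. by apply: fine_ge0; apply: integral_ge0 => t _; rewrite lee_fin. Qed.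

Lemma excessE : 1 + v * (mean_claim + excess) = excess.
Proof.
have : 1 - v != 0 by move: v01; case/andP=> _; rewrite subr_eq0 eq_sym => /lt_eqF ->.
by rewrite /excess => v1; field.
Qed.

Lemma excess_ge0 : 0 <= excess.
Proof.
case/andP: v01 => v0 v1; rewrite divr_ge0 //; last by rewrite subr_ge0 ltW.
by rewrite addr_ge0 // mulr_ge0 ?mean_claim_ge0 // ltW.
Qed.

Lemma integral_claimD (a : R) :
  (\int[P]_t ((C 0%N t)%:R + a)%:E = (mean_claim + a)%:E)%E.
Proof.
rewrite (_ : (fun t => _) = (fun t => (C 0%N t)%:R%:E + a%:E)%E) //.
rewrite integralD //; last exact: integrable_cstT.
rewrite integral_cstT EFinD; congr (_ + _)%E.
by rewrite /mean_claim /Rintegral fineK //; exact: integrable_fin_num.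
Qed.

Section Chain.
Context (c m : int -> R) (S : int -> nat -> int).
Hypothesis c_bound : forall x, 0 <= c x <= shortfall x + 1.
Hypothesis m_bound : forall x, 0 <= m x <= v.
Hypothesis S_bound : forall x k, m x != 0 -> - S x k <= k%:Z.

Let c0 x : 0 <= c x. Proof. by case/andP: (c_bound x). Qed.
Let m0 x : 0 <= m x. Proof. by case/andP: (m_bound x). Qed.

Definition rvalue x : R := fine (value c m S P C x).

Lemma value_bound x : (value c m S P C x <= (shortfall x + excess)%:E)%E.
Proof.
apply: (value_le c0 m0 mC (f := fun x => (shortfall x + excess)%:E)) => {}x; last first.
  by rewrite lee_fin addr_ge0 ?shortfall_ge0 ?excess_ge0.
have [/andP[_ cx] /andP[_ mx]] := (c_bound x, m_bound x).
have [m_eq0|m_neq0] := eqVneq (m x) 0.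
  rewrite m_eq0 mul0e adde0 lee_fin (le_trans cx) // lerD2l -excessE lerDl.
  case/andP: v01 => v0 v1; rewrite mulr_ge0 ?(ltW v0) //.
  by rewrite addr_ge0 ?mean_claim_ge0 ?excess_ge0.
have int_le : (\int[P]_t (shortfall (S x (C 0%N t)) + excess)%:E
               <= (mean_claim + excess)%:E)%E.
  rewrite -integral_claimD; apply: ge0_le_integral => //.
  - by move=> t _; rewrite lee_fin addr_ge0 ?shortfall_ge0 ?excess_ge0.
  - exact: (measurable_claim_EFin (fun k => shortfall (S x k) + excess)).
  - exact: (measurable_claim_EFin (fun k => k%:R + excess)).
  - by move=> t _; rewrite lee_fin lerD2r shortfall_le_nat // S_bound.
apply: (@le_trans _ _ ((c x)%:E + (m x)%:E * (mean_claim + excess)%:E)%E).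
  by rewrite leeD2l // lee_wpmul2l ?lee_fin.
rewrite -EFinM -EFinD lee_fin -[in leRHS]excessE addrA lerD //.
by rewrite ler_wpM2r // addr_ge0 ?mean_claim_ge0 ?excess_ge0.
Qed.

Lemma valueK x : value c m S P C x = (rvalue x)%:E.
Proof.
rewrite /rvalue fineK // ge0_fin_numE; last exact: value_ge0.
exact: (le_lt_trans (value_bound x)) (ltry _).
Qed.

Lemma rvalue_ge0 x : 0 <= rvalue x.
Proof. by rewrite -lee_fin -valueK; exact: value_ge0. Qed.

Lemma rvalue_le x : rvalue x <= shortfall x + excess.
Proof. by rewrite -lee_fin -valueK value_bound. Qed.

Lemma rvalue_next_integrable : next_integrable rvalue.
Proof.
apply: (growth_next_integrable (L := excess)) => x.
by rewrite ger0_norm ?rvalue_ge0 // rvalue_le.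
Qed.

Lemma rvalue_stop x : m x = 0 -> rvalue x = c x.
Proof.
by move=> mx; rewrite /rvalue value_step // mx mul0e adde0.
Qed.

Lemma rvalue_step x y : (forall k, S x k = y + 1 - k%:Z) ->
  rvalue x = c x + m x * next_mean rvalue y.
Proof.
move=> Sx; have := rvalue_next_integrable y => inty.
rewrite {1}/rvalue value_step //.
under eq_integral do rewrite valueK Sx.
have fin : (\int[P]_t (rvalue (y + 1 - (C 0%N t)%:Z))%:E)%E \is a fin_num.
  exact: integrable_fin_num.
by rewrite -(fineK fin).
Qed.

End Chain.

(** * First exit of the walk from a set of states *)

(** [walk] for a deterministic claim sequence. *)
Definition surplus (x : int) (w : nat -> nat) (n : nat) : int :=
  x + n%:Z - \sum_(i < n) (w i)%:Z.

Definition walk_step (x : int) (k : nat) : int := x + 1 - k%:Z.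

Lemma surplus0 x w : surplus x w 0 = x.
Proof. by rewrite /surplus big_ord0; lia. Qed.

Lemma surplusS x w n :
  surplus x w n.+1 = surplus (walk_step x (w 0%N)) (fun i => w i.+1) n.
Proof.
rewrite /surplus /walk_step big_ord_recl /=.
rewrite (eq_bigr (fun i : 'I_n => (w i.+1)%:Z)) //.
by set s := (\sum_(i < n) _); lia.
Qed.

Lemma first_time_Some (A : pred nat) n :
  (first_time A == Some n) = A n && all (predC A) (iota 0 n).
Proof.
rewrite /first_time; case: pselect => [exA|nA]; last first.
  by apply/eqP/andP => // -[An _]; case: nA; exists n.
case: ex_minnP => k Ak mink; apply/eqP/andP => [[<-]|[An /allP nA]].
  split=> //; apply/allP => j; rewrite mem_iota /= => jk.
  by apply/negP => /mink; rewrite leqNgt jk.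
congr Some; apply/eqP; rewrite eqn_leq mink //= leqNgt.
by apply/negP => kn; move: (nA k); rewrite mem_iota /= Ak => /(_ kn).
Qed.

Lemma first_time_None (A : pred nat) n : first_time A = None -> ~~ A n.
Proof.
rewrite /first_time; case: pselect => // nA _.
by apply/negP => An; apply: nA; exists n.
Qed.

Section Exit.
Context (D : pred int) (r : int -> R).
Hypothesis D_neg : forall x, x <= -1 -> D x.
Hypothesis r_bound : forall x, D x -> 0 <= r x <= shortfall x + 1.

(** The reward is collected in the first state of [D], and the zero factor there
    stops the process. *)
Definition exit_reward x := if D x then r x else 0.
Definition exit_factor x := if D x then 0 else v.

Definition exit_value : int -> R := rvalue exit_reward exit_factor walk_step.

Let reward_bound x : 0 <= exit_reward x <= shortfall x + 1.
Proof.
rewrite /exit_reward; case: ifP => [/r_bound|_] //.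
by rewrite lexx addr_ge0 ?shortfall_ge0.
Qed.

Let factor_bound x : 0 <= exit_factor x <= v.
Proof.
by case/andP: v01 => v0 _; rewrite /exit_factor; case: ifP; rewrite lexx ?(ltW v0).
Qed.

Let walk_step_bound x k : exit_factor x != 0 -> - walk_step x k <= k%:Z.
Proof.
rewrite /exit_factor /walk_step; case: ifP => [_|/negbT nDx _]; first by rewrite eqxx.
have nx : ~~ (x <= -1) by apply: contra nDx; exact: D_neg.
by lia.
Qed.

Let reward_ge0 x : 0 <= exit_reward x. Proof. by case/andP: (reward_bound x). Qed.
Let factor_ge0 x : 0 <= exit_factor x. Proof. by case/andP: (factor_bound x). Qed.

Lemma exit_value_stop x : D x -> exit_value x = r x.
Proof.
by move=> Dx; rewrite /exit_value rvalue_stop // /exit_factor ?/exit_reward Dx.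
Qed.

Lemma exit_value_harmonic x : ~~ D x -> harmonic v exit_value x.
Proof.
move=> /negbTE nDx; rewrite /harmonic /exit_value (@rvalue_step _ _ _ _ _ _ _ x) //.
by rewrite /exit_factor /exit_reward nDx add0r.
Qed.

Lemma exit_value_next_integrable : next_integrable exit_value.
Proof. exact: rvalue_next_integrable. Qed.

(** [v ^ tau * r (X(tau))] for the entrance time [tau] of [D], and zero when
    [tau] is infinite. *)
Definition stopped_reward (x : int) (t : T) : R :=
  if first_time (fun n => D (walk C x t n)) is Some n
  then v ^+ n * r (walk C x t n) else 0.

Lemma payoff_exit n x w :
  payoff exit_reward exit_factor walk_step n x w =
  if first_time (fun n => D (surplus x w n)) == Some n
  then v ^+ n * r (surplus x w n) else 0.
Proof.
rewrite first_time_Some; elim: n x w => [|n ih] x w.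
  by rewrite surplus0 /= andbT expr0 mul1r.
rewrite [LHS]/= ih surplusS /= surplus0 -[1%N]addn0 iotaDl all_map /exit_factor.
rewrite (eq_all (a2 := predC (fun j =>
  D (surplus (walk_step x (w 0%N)) (fun i => w i.+1) j)))); last first.
  by move=> j; rewrite /= add1n surplusS.
case: (D x); first by rewrite mul0r andbF.
by rewrite /=; case: ifP => _; rewrite ?mulr0 // exprS mulrA.
Qed.

Lemma stopped_rewardE x t :
  ((stopped_reward x t)%:E = \sum_(0 <= n <oo)
    (payoff exit_reward exit_factor walk_step n x (fun i => C i t))%:E)%E.
Proof.
have pE n := payoff_exit n x (fun i => C i t).
rewrite /stopped_reward; case E: (first_time _) => [k|]; last first.
  by rewrite eseries0 // => n _ _; rewrite pE E.
rewrite (nneseriesD1 (n := k)) //; last by move=> n _; rewrite lee_fin payoff_ge0.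
rewrite eseries0 ?adde0; first by rewrite pE E eqxx.
by move=> n _ /= nk; rewrite pE E (inj_eq Some_inj) eq_sym (negbTE nk).
Qed.

Lemma integral_stopped_reward x :
  (\int[P]_t (stopped_reward x t)%:E = (exit_value x)%:E)%E.
Proof.
under eq_integral do rewrite stopped_rewardE.
by rewrite (valueE walk_step reward_ge0 factor_ge0 mC indC lawC) valueK //.
Qed.

Lemma stopped_reward_ge0 x t : 0 <= stopped_reward x t.
Proof.
rewrite -lee_fin stopped_rewardE; apply: nneseries_ge0 => n _ _.
by rewrite lee_fin payoff_ge0.
Qed.

Lemma measurable_stopped_reward x :
  measurable_fun setT (fun t => (stopped_reward x t)%:E).
Proof.
under eq_fun do rewrite stopped_rewardE.
apply: (ge0_emeasurable_sum (P := xpredT)) => [k t _ _|k _].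
  by rewrite lee_fin payoff_ge0.
exact: (measurable_payoff _ _ _ mC k x 0).
Qed.

Lemma integrable_stopped_reward x :
  P.-integrable setT (fun t => (stopped_reward x t)%:E).
Proof.
apply/integrableP; split; first exact: measurable_stopped_reward.
under eq_integral do rewrite gee0_abs ?lee_fin ?stopped_reward_ge0 //.
by rewrite integral_stopped_reward ltry.
Qed.

End Exit.

(** * The ruin transform and the first scale function *)

(** Stopping at the earlier of two times that never coincide and paying only if
    [B] occurs is the same as stopping at [B] on the event that it comes
    first. *)
Lemma first_time_race (A B : pred nat) (f : nat -> R) :
  (forall n, A n -> ~~ B n) ->
  (if first_time (fun n => A n || B n) is Some n then f n * (B n)%:R else 0) =
  (if first_time B is Some n then f n else 0) *
    (time_lt (first_time B) (first_time A))%:R.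
Proof.
move=> AB; case EB: (first_time B) => [n|]; last first.
  rewrite mul0r; case: first_time => // n.
  by rewrite (negbTE (first_time_None n EB)) mulr0.
move/eqP: (EB); rewrite first_time_Some => /andP[Bn /allP nB].
case EA: (first_time A) => [k|] /=; last first.
  suff /eqP -> : first_time (fun n => A n || B n) == Some n by rewrite Bn.
  rewrite first_time_Some Bn orbT; apply/allP => j jn /=.
  by rewrite negb_or (first_time_None j EA); exact: nB.
move/eqP: (EA); rewrite first_time_Some => /andP[Ak /allP nA].
have [nk|kn] := ltnP n k.
  suff /eqP -> : first_time (fun n => A n || B n) == Some n by rewrite Bn.
  rewrite first_time_Some Bn orbT; apply/allP => j jn /=.
  rewrite negb_or; apply/andP; split; last exact: nB.
  by apply: nA; move: jn; rewrite !mem_iota; lia.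
suff /eqP -> : first_time (fun n => A n || B n) == Some k.
  by rewrite (negbTE (AB _ Ak)) !mulr0.
rewrite first_time_Some Ak; apply/allP => j jk /=.
rewrite negb_or; apply/andP; split; first exact: nA.
by apply: nB; move: jk; rewrite !mem_iota; lia.
Qed.

Let v_gt0 : 0 < v. Proof. by case/andP: v01. Qed.
Let v_lt1 : v < 1. Proof. by case/andP: v01. Qed.

Definition ruined (x : int) : bool := x <= -1.

Lemma ruined_expr_bound w x : 0 < w <= 1 -> ruined x ->
  0 <= w ^ (- x) <= shortfall x + 1.
Proof.
rewrite /ruined => /andP[w0 w1]; case: x => // n _.
rewrite NegzE opprK -exprnP exprn_ge0 ?(ltW w0) //=.
by rewrite (le_trans (exprn_ile1 _ (ltW w0) w1)) // lerDr shortfall_ge0.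
Qed.

Lemma PsiE w x : 0 < w <= 1 ->
  Psi P C v x w = exit_value ruined (fun y => w ^ (- y)) x.
Proof.
move=> w01; rewrite /Psi /expect_on unlock.
rewrite -[RHS]/(fine (exit_value ruined (fun y => w ^ (- y)) x)%:E).
rewrite -integral_stopped_reward //; last by move=> y; exact: ruined_expr_bound.
congr fine; apply: eq_integral => t _; congr EFin.
rewrite /stopped_reward indicE /tau_minus /ruined.
case E: (first_time _) => [n|] /=; last by rewrite !mul0r.
by rewrite mem_set ?mulr1 //= E.
Qed.

Section Upcrossing.
Context (y : nat).

Definition reached (x : int) : bool := y%:Z <= x.

Definition exited (x : int) : bool := ruined x || reached x.

(** The mean discount factor at the time [y] is reached before ruin, as a
    function of the starting point. *)
Definition upcrossing : int -> R := exit_value exited (fun x => (reached x)%:R).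

Let exited_ruined x : x <= -1 -> exited x.
Proof. by rewrite /exited /ruined => ->. Qed.

Let indicator_bound x : exited x -> (0 : R) <= (reached x)%:R <= shortfall x + 1.
Proof.
move=> _; rewrite ler0n /= (@le_trans _ _ 1) //; first by case: (reached x).
by rewrite lerDr shortfall_ge0.
Qed.

Lemma upcrossing_ruined x : ruined x -> upcrossing x = 0.
Proof.
move=> rx; rewrite /upcrossing exit_value_stop //; last by rewrite /exited rx.
by rewrite (_ : reached x = false) //; move: rx; rewrite /ruined /reached; lia.
Qed.

Lemma upcrossing_top : upcrossing y%:Z = 1.
Proof. by rewrite /upcrossing exit_value_stop // /exited /reached lexx ?orbT. Qed.

Lemma upcrossing_harmonic x : 0 <= x < y%:Z -> harmonic v upcrossing x.
Proof.
by move=> xy; apply: exit_value_harmonic => //; rewrite /exited /ruined /reached; lia.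
Qed.

Lemma upcrossing_next_integrable : next_integrable upcrossing.
Proof. exact: exit_value_next_integrable. Qed.

(** Otherwise [upcrossing] and the zero function would agree on [x <= 0], hence
    also at [y], where [upcrossing] is one. *)
Lemma upcrossing0_neq0 : upcrossing 0 != 0.
Proof.
apply/eqP => up0; have := oner_neq0 R.
suff <- : 0 * upcrossing y%:Z = 1 by rewrite mul0r eqxx.
rewrite -upcrossing_top.
apply: (harmonic_unique (n := y) (f := fun x => 0 * upcrossing x) v_gt0) => //.
- exact/next_integrableZ/upcrossing_next_integrable.
- exact: upcrossing_next_integrable.
- move=> x; rewrite mul0r le_eqVlt => /predU1P[->|x0]; first by rewrite up0.
  by rewrite upcrossing_ruined // /ruined; lia.
- move=> x xy; apply: harmonicZ; first exact: upcrossing_next_integrable.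
  exact: upcrossing_harmonic.
- exact: upcrossing_harmonic.
Qed.

Lemma W_upcrossing0 : W P p C v y%:Z = (p 0%N * upcrossing 0)^-1.
Proof.
rewrite /W ltNge le0z_nat /= /expect_on unlock; congr (_ * _)^-1.
rewrite -[RHS]/(fine (upcrossing 0)%:E) -integral_stopped_reward //.
congr fine; apply: eq_integral => t _; congr EFin.
have disj n : walk C 0 t n <= -1 -> ~~ reached (walk C 0 t n).
  by rewrite /reached; lia.
rewrite indicE /stopped_reward -[RHS]/(if first_time (fun n =>
  (walk C 0 t n <= -1) || reached (walk C 0 t n)) is Some n then
  v ^+ n * (reached (walk C 0 t n))%:R else 0).
rewrite (first_time_race (fun n => v ^+ n) disj) /discount.
by congr (_ * (nat_of_bool _)%:R); apply/idP/idP; rewrite inE.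
Qed.

End Upcrossing.

(** To climb from 0 to [y] the walk must pass through [z].  In place of the
    strong Markov property, uniqueness applies to
    [upcrossing z 0 * upcrossing y x] and [upcrossing y 0 * upcrossing z x],
    which agree on [x <= 0]; at [x = z] this is the claim. *)
Lemma upcrossingM (z y : nat) : (z <= y)%N ->
  upcrossing z 0 * upcrossing y z%:Z = upcrossing y 0.
Proof.
move=> zy; rewrite -[RHS]mulr1 -(upcrossing_top z).
have upZ a u : next_integrable (fun x => a * upcrossing u x).
  exact/next_integrableZ/upcrossing_next_integrable.
apply: (harmonic_unique (n := z) (f := fun x => upcrossing z 0 * upcrossing y x)
  (g := fun x => upcrossing y 0 * upcrossing z x) v_gt0) => //.
- move=> x; rewrite le_eqVlt => /predU1P[->|x0]; first by rewrite mulrC.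
  have rx : ruined x by rewrite /ruined; lia.
  by rewrite !(upcrossing_ruined _ rx) !mulr0.
- move=> x xz; apply: harmonicZ; first exact: upcrossing_next_integrable.
  by apply: upcrossing_harmonic; lia.
- move=> x xz; apply: harmonicZ; first exact: upcrossing_next_integrable.
  exact: upcrossing_harmonic.
Qed.

(** The definition of [W] uses a different target level at each point; here a
    single target serves all [x <= y], so [W] inherits the first-step equation
    of [upcrossing y]. *)
Lemma W_upcrossing (y : nat) x : x <= y%:Z ->
  (p 0%N * upcrossing y 0)^-1 * upcrossing y x = W P p C v x.
Proof.
case: x => [z|z] xy; last first.
  by rewrite (@upcrossing_ruined _ (Negz z)) ?mulr0.
rewrite (W_upcrossing0 z) -(@upcrossingM z y) //.
rewrite mulrA invfM -mulrA mulVf ?mulr1 //.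
have := upcrossing0_neq0 y; rewrite -(@upcrossingM z y) // mulf_eq0 negb_or.
by case/andP.
Qed.

Lemma W_harmonic x : 0 <= x -> harmonic v (W P p C v) x.
Proof.
case: x => // n _.
apply: (eq_harmonic
  (f := fun z => (p 0%N * upcrossing n.+1 0)^-1 * upcrossing n.+1 z)).
  by move=> z zn; apply: W_upcrossing; lia.
apply: harmonicZ; first exact: upcrossing_next_integrable.
by apply: upcrossing_harmonic; lia.
Qed.

Lemma W_next_integrable : next_integrable (W P p C v).
Proof.
move=> x; set y := absz (x + 1).
have := next_integrableZ (p 0%N * upcrossing y 0)^-1
  (upcrossing_next_integrable y) x.
apply: eq_integrable => // t _; rewrite W_upcrossing //; lia.
Qed.

(** * The second scale function and its derivative *)
Local Notation Wv := (W P p C v).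
Local Notation Zv := (Z P p C v).
Local Notation Z1v := (Z1 P p C v).

Let one01 : 0 < (1 : R) <= 1. Proof. by rewrite ltr01 lexx. Qed.

Definition mean_deficit : int -> R := exit_value ruined (fun x => - x%:~R).

Let ruined_neg x : x <= -1 -> ruined x. Proof. by []. Qed.

Lemma deficit_bound x : ruined x -> 0 <= (- x%:~R : R) <= shortfall x + 1.
Proof.
move=> rx; have x0 : x <= 0 by move: rx; rewrite /ruined; lia.
by rewrite -shortfall_le0 // shortfall_ge0 /= lerDl.
Qed.

Lemma mean_deficit_harmonic x : 0 <= x -> harmonic v mean_deficit x.
Proof.
move=> x0; apply: exit_value_harmonic => //; first exact: deficit_bound.
by rewrite /ruined; lia.
Qed.

Lemma mean_deficit_next_integrable : next_integrable mean_deficit.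
Proof. exact: (exit_value_next_integrable ruined_neg deficit_bound). Qed.

Lemma mean_deficit_ruined x : ruined x -> mean_deficit x = - x%:~R.
Proof.
by move=> rx; rewrite /mean_deficit exit_value_stop //; exact: deficit_bound.
Qed.

Lemma Psi1_exit_value :
  (fun x => Psi P C v x 1) = exit_value ruined (fun y => 1 ^ (- y)).
Proof. by apply/funext => x; rewrite PsiE. Qed.

Lemma W_neg x : ruined x -> Wv x = 0.
Proof. by rewrite /W /ruined => rx; rewrite ifT //; lia. Qed.

Lemma Z_next_integrable : next_integrable Zv.
Proof.
apply: next_integrableD; last exact/next_integrableZ/W_next_integrable.
rewrite Psi1_exit_value.
by apply: (exit_value_next_integrable ruined_neg) => y; exact: ruined_expr_bound.
Qed.

Lemma Z_harmonic x : 0 <= x -> harmonic v Zv x.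
Proof.
move=> x0; have intPsi : next_integrable (fun y => Psi P C v y 1).
  rewrite Psi1_exit_value.
  by apply: (exit_value_next_integrable ruined_neg) => y; exact: ruined_expr_bound.
apply: harmonicD => //; first exact/next_integrableZ/W_next_integrable.
  rewrite Psi1_exit_value; apply: exit_value_harmonic => //.
    by move=> y; exact: ruined_expr_bound.
  by rewrite /ruined; lia.
by apply: harmonicZ; [exact: W_next_integrable|exact: W_harmonic].
Qed.

Lemma Z_le0 x : x <= 0 -> Zv x = 1.
Proof.
rewrite le_eqVlt => /predU1P[->|x0]; first exact: Zw0.
have rx : ruined x by rewrite /ruined; lia.
rewrite /Z /Zw PsiE // exit_value_stop //; last by move=> y; exact: ruined_expr_bound.
by rewrite W_neg // mulr0 addr0 exp1rz.
Qed.

(** By induction [Z n] is the maximum of [Z] up to [n], so the mean of [Z] after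
    one period from [n] is at most [Z n + p 0 * (Z (n + 1) - Z n)]; this mean is
    [Z n / v], which exceeds [Z n] because [Z n >= 1] and [v < 1]. *)
Lemma Z_fwd_diff_gt0 (n : nat) : 0 < fwd_diff Zv n.
Proof.
rewrite /fwd_diff subr_gt0.
suff : [/\ forall y, y <= n%:Z -> Zv y <= Zv n%:Z & 1 <= Zv n%:Z] /\
    Zv n%:Z < Zv n.+1%:Z by case.
have increase m : (forall y, y <= m%:Z -> Zv y <= Zv m%:Z) -> 1 <= Zv m%:Z ->
    Zv m%:Z < Zv m.+1%:Z.
  move=> Zle Z1; set a := Zv m%:Z in Zle Z1 *; set e := Zv m.+1%:Z - a.
  (* [g] dominates [Z] on the states that can follow [m], with equality at the
     top state [m + 1]. *)
  pose g y := a + e * (y == m%:Z + 1)%:R.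
  have intg : next_integrable g.
    apply: (growth_next_integrable (L := `|a| + `|e|)) => y.
    rewrite ler_wpDl ?shortfall_ge0 // (le_trans (ler_normD _ _)) // lerD2l normrM.
    by rewrite ler_piMr // normr_nat; case: (_ == _).
  have le_mean : next_mean Zv m%:Z <= a + p 0%N * e.
    rewrite -(next_mean_atom a e m%:Z); apply: le_Rintegral => //.
    - exact: Z_next_integrable.
    - exact: intg.
    - move=> t _; set y := _ - _; have ym : y <= m%:Z + 1 by rewrite /y; lia.
      case: eqVneq => [->|ny]; last by rewrite mulr0 addr0 Zle //; lia.
      by rewrite mulr1 /e subrKC (_ : m%:Z + 1 = m.+1%:Z) //; lia.
  have aE : a = v * next_mean Zv m%:Z by apply: Z_harmonic.
  have e0 : 0 < e.
    rewrite -(pmulr_rgt0 _ p0_gt0).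
    have : a <= v * (a + p 0%N * e) by rewrite {1}aE ler_pM2l.
    rewrite mulrDr => av; rewrite -(pmulr_rgt0 _ v_gt0).
    have va : v * a < a by rewrite gtr_pMl ?(lt_le_trans ltr01).
    by rewrite -(ltrD2l (v * a)) addr0 (lt_le_trans va).
  by rewrite -subr_gt0.
elim: n => [|n [[Zle Z1] Zlt]].
  have Z0 : Zv 0%N%:Z = 1 by exact: Z_le0.
  have Zle y : y <= 0%N%:Z -> Zv y <= Zv 0%N%:Z by move=> y0; rewrite !Z_le0.
  by split; [split => //; rewrite Z0|apply: increase => //; rewrite Z0].
have Zle' y : y <= n.+1%:Z -> Zv y <= Zv n.+1%:Z.
  move=> yn; have [yn'|ny] := leP y n%:Z.
    exact: le_trans (Zle _ yn') (ltW Zlt).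
  by rewrite (_ : y = n.+1%:Z) //; lia.
have Z1' : 1 <= Zv n.+1%:Z by exact: le_trans Z1 (ltW Zlt).
by split => //; exact: increase.
Qed.

Lemma expr_slope (w : R) n : w < 1 ->
  (w ^+ n - 1) / (w - 1) = \sum_(i < n) w ^+ i.
Proof.
by move=> w1; rewrite subrX1 mulrAC mulfV ?mul1r // subr_eq0 lt_eqF.
Qed.

(** By the geometric sum, the slope of a power between [w] and 1 is at most its
    derivative at 1, uniformly in [w]: this provides the dominating function for
    [Psi_slope_cvg]. *)
Lemma expr_slope_bound (w : R) x : 0 < w < 1 -> ruined x ->
  `|(w ^ (- x) - 1 ^ (- x)) / (w - 1)| <= - x%:~R.
Proof.
case/andP=> w0 w1; case: x => // n _; rewrite exp1rz NegzE opprK -exprnP.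
rewrite expr_slope // ger0_norm; last first.
  by apply: sumr_ge0 => i _; rewrite exprn_ge0 ?ltW.
rewrite mulrNz opprK (le_trans (y := \sum_(i < n.+1) 1)) //.
  by apply: ler_sum => i _; rewrite exprn_ile1 // ltW.
by rewrite sumr_const card_ord.
Qed.

Lemma expr_slope_cvg (u : nat -> R) x : (forall n, u n < 1) ->
  u n @[n --> \oo] --> (1 : R) -> ruined x ->
  (u n ^ (- x) - 1 ^ (- x)) / (u n - 1) @[n --> \oo] --> (- x%:~R : R).
Proof.
move=> u1 cu; case: x => // k _; rewrite exp1rz NegzE opprK mulrNz opprK.
under eq_cvg do rewrite -exprnP expr_slope //.
have pow_cvg j : u n ^+ j @[n --> \oo] --> (1 : R).
  rewrite -[X in _ --> X](expr1n R j).
  exact: (cvg_comp _ _ cu (@exprn_continuous R j 1)).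
suff sum_cvg j : \sum_(i < j) u n ^+ i @[n --> \oo] --> (j%:Z%:~R : R).
  exact: sum_cvg.
elim: j => [|j ih].
  rewrite (_ : (fun n => _) = (fun=> 0)); first exact: cvg_cst.
  by apply/funext => n; rewrite big_ord0.
rewrite (_ : (fun n => _) = (fun n => \sum_(i < j) u n ^+ i + u n ^+ j)); last first.
  by apply/funext => n; rewrite big_ord_recr.
by rewrite -[j.+1]addn1 PoszD intrD; apply: cvgD.
Qed.

(** Differentiation under the expectation: the slope of [w ^ (- X(tau))] between
    [w] and 1 is dominated by the deficit [- X(tau)] and tends to it, and the
    discounted deficit is integrable since the claims have a finite mean. *)
Lemma Psi_slope_cvg x :
  (Psi P C v x w - Psi P C v x 1) / (w - 1) @[w --> 1^'-] --> mean_deficit x.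
Proof.
apply/cvg_at_leftP => u [u1 cu].
(* A sequence tending to 1 may start outside of the range [0 < w] on which [Psi]
   is an exit value; replacing its early terms does not affect the limit. *)
pose u' n := if 0 < u n then u n else 2^-1.
have u'E : \forall n \near \oo, u' n = u n.
  have u0 : \forall n \near \oo, 0 < u n by exact: (cvgr_gt _ cu) ltr01.
  by near=> n; rewrite /u' ifT //; near: n.
have u'01 n : 0 < u' n < 1.
  rewrite /u'; case: ifP => [->|_]; rewrite ?u1 //.
  by rewrite invr_gt0 ltr0n invf_lt1 ?ltr1n.
have u'1 n : u' n < 1 by case/andP: (u'01 n).
have cu' : u' n @[n --> \oo] --> (1 : R).
  apply: cvg_trans cu; apply: near_eq_cvg.
  by near=> n; apply/esym; near: n.
suff lim' : (Psi P C v x (u' n) - Psi P C v x 1) / (u' n - 1) @[n --> \oo] -->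
    mean_deficit x.
  apply: cvg_trans lim'; apply: near_eq_cvg.
  have : \forall n \near \oo, u' n = u n by [].
  by apply: filterS => n ->.
pose ru w := stopped_reward ruined (fun y => w ^ (- y)) x.
pose deficit := stopped_reward ruined (fun y => - y%:~R) x.
have int_ru w : 0 < w <= 1 -> P.-integrable setT (EFin \o ru w).
  move=> w01; apply: integrable_stopped_reward => // y.
  exact: ruined_expr_bound.
have PsiR w : 0 < w <= 1 -> Psi P C v x w = \int[P]_t ru w t.
  move=> w01; rewrite PsiE // /Rintegral integral_stopped_reward // => y.
  exact: ruined_expr_bound.
have u'le n : 0 < u' n <= 1 by case/andP: (u'01 n) => -> /ltW ->.
pose G n t := (ru (u' n) t - ru 1 t) / (u' n - 1).
have intG n : P.-integrable setT (EFin \o G n).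
  have intB := integrableB measurableT (int_ru _ (u'le n)) (int_ru _ one01).
  exact: eq_integrable (integrableZr measurableT (u' n - 1)^-1 intB).
have PsiG n :
    (Psi P C v x (u' n) - Psi P C v x 1) / (u' n - 1) = \int[P]_t G n t.
  rewrite !PsiR // -RintegralB //; [|exact: int_ru|exact: int_ru].
  rewrite /G RintegralZr //.
  exact: (integrableB measurableT (int_ru _ (u'le n)) (int_ru _ one01)).
under eq_cvg do rewrite PsiG.
have int_deficit : P.-integrable setT (EFin \o deficit).
  by apply: integrable_stopped_reward => // y; exact: deficit_bound.
have GE n t : G n t = stopped_reward ruined
    (fun y => (u' n ^ (- y) - 1 ^ (- y)) / (u' n - 1)) x t.
  rewrite /G /ru /stopped_reward; case: first_time => [k|]; last first.
    by rewrite subrr mul0r.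
  by rewrite -mulrBr mulrA.
have stop_ruined t k : first_time (fun n => ruined (walk C x t n)) = Some k ->
    ruined (walk C x t k) by exact: first_timeP.
have lim_int : (\int[P]_t (G n t)%:E)%E @[n --> \oo] --> (mean_deficit x)%:E.
  rewrite /mean_deficit -integral_stopped_reward //; last exact: deficit_bound.
  have [|||||_ _] := @dominated_convergence _ _ _ P _ measurableT
    (fun n => EFin \o G n) (EFin \o deficit) (EFin \o deficit); last by [].
  - by move=> n; exact: measurable_int (intG n).
  - exact: measurable_int int_deficit.
  - apply: aeW => t _; apply: cvg_EFin; first exact: nearW.
    rewrite (_ : _ \o _ = (fun n => G n t)) //=.
    under eq_cvg do rewrite GE.
    rewrite /deficit /stopped_reward.
    case E: (first_time _) => [k|]; last exact: cvg_cst.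
    apply: cvgM; first exact: cvg_cst.
    by apply: expr_slope_cvg => //; exact: stop_ruined E.
  - exact: int_deficit.
  - apply: aeW => t n _; rewrite /= lee_fin GE /deficit /stopped_reward.
    case E: (first_time _) => [k|]; last by rewrite normr0.
    have v0 := ltW v_gt0.
    rewrite normrM ger0_norm ?exprn_ge0 // ler_wpM2l ?exprn_ge0 //.
    by apply: expr_slope_bound => //; exact: stop_ruined E.
exact: fine_cvg lim_int.
Unshelve. all: by end_near.
Qed.

(** [Z] depends on [w] through [Psi v x w] and, in [alpha], through
    [Psi v 0 w]. *)
Lemma Z1E x : Z1v x = (-1) * mean_deficit x + mean_deficit 0 / Wv 0 * Wv x.
Proof.
rewrite /Z1 (_ : lim _ = mean_deficit x - mean_deficit 0 / Wv 0 * Wv x).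
  by rewrite opprB addrC mulN1r.
apply: cvg_lim => //.
rewrite (_ : (fun w => _) = (fun w => (Psi P C v x w - Psi P C v x 1) / (w - 1) -
    (Psi P C v 0 w - Psi P C v 0 1) / (w - 1) * ((Wv 0)^-1 * Wv x))); last first.
  by apply/funext => w; rewrite /Zw /alpha; ring.
rewrite -mulrA; apply: cvgB; first exact: Psi_slope_cvg.
by apply: cvgMl; exact: Psi_slope_cvg.
Qed.

Lemma Z1_next_integrable : next_integrable Z1v.
Proof.
rewrite (_ : Z1v = fun x =>
  (-1) * mean_deficit x + mean_deficit 0 / Wv 0 * Wv x).
  apply: next_integrableD; apply: next_integrableZ.
    exact: mean_deficit_next_integrable.
  exact: W_next_integrable.
by apply/funext => x; exact: Z1E.
Qed.

Lemma Z1_harmonic x : 0 <= x -> harmonic v Z1v x.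
Proof.
move=> x0.
rewrite (_ : Z1v = fun x =>
  (-1) * mean_deficit x + mean_deficit 0 / Wv 0 * Wv x); last first.
  by apply/funext => y; exact: Z1E.
have intd := mean_deficit_next_integrable; have intW := W_next_integrable.
apply: harmonicD; try exact: next_integrableZ.
  by apply: harmonicZ => //; exact: mean_deficit_harmonic.
by apply: harmonicZ => //; exact: W_harmonic.
Qed.

Lemma Z1_le0 x : x <= 0 -> Z1v x = x%:~R.
Proof.
rewrite Z1E le_eqVlt => /predU1P[->|x0].
  by rewrite mulfVK ?mulN1r ?addNr // W0 invr_neq0 // gt_eqF.
have rx : ruined x by rewrite /ruined; lia.
by rewrite (W_neg rx) mulr0 addr0 mean_deficit_ruined // mulN1r opprK.
Qed.

(** * The doubly reflected process *)
Section Reflected.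
Context (b : nat).

(** Here the state [x] is the capital just before the injection and the dividend
    of a period, so that the injection is a function of the state. *)
Definition reflected_step (x : int) (k : nat) : int :=
  x + injection x - dividend b x + 1 - k%:Z.

Definition mean_bailouts : int -> R := rvalue shortfall (fun=> v) reflected_step.

(** [pre_surplus] is defined by recursion on the last claim and [payoff] on the
    first one; this is the bridge between them. *)
Lemma pre_surplusS (C' : nat -> T -> nat) x t l :
  pre_surplus C' b x t l.+1 =
  pre_surplus (fun i => C' i.+1) b (reflected_step x (C' 0%N t)) t l.
Proof.
by elim: l => [//|l ih]; rewrite [LHS]/= -/(pre_surplus C' b x t l.+1) ih.
Qed.

Lemma payoff_bailout (C' : nat -> T -> nat) x t n :
  payoff shortfall (fun=> v) reflected_step n x (fun i => C' i t) =
  v ^+ n * (bailout C' b x t n)%:~R.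
Proof.
elim: n C' x => [|n ih] C' x; first by rewrite expr0 mul1r.
rewrite [LHS]/= (ih (fun i => C' i.+1)) mulrA -exprS.
by rewrite /bailout -pre_surplusS.
Qed.

Let shortfall_bound x : 0 <= shortfall x <= shortfall x + 1.
Proof. by rewrite shortfall_ge0 lerDl ler01. Qed.

Let v_bound (x : int) : 0 <= v <= v.
Proof. by rewrite (ltW v_gt0) lexx. Qed.

Let reflected_step_bound (x : int) k : v != 0 -> - reflected_step x k <= k%:Z.
Proof. by move=> _; rewrite /reflected_step /injection /dividend; lia. Qed.

Lemma V_BE x : V_B P C v b x = (mean_bailouts x)%:E.
Proof.
have v_ge0 (_ : int) : 0 <= v by exact: ltW.
rewrite /mean_bailouts -valueK //.
rewrite -(valueE reflected_step shortfall_ge0 v_ge0 mC indC lawC).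
apply: eq_integral => t _; apply: eq_eseriesr => l _.
by rewrite payoff_bailout.
Qed.

Lemma mean_bailouts_next_integrable : next_integrable mean_bailouts.
Proof.
exact: (rvalue_next_integrable shortfall_bound v_bound reflected_step_bound).
Qed.

Lemma mean_bailouts_step x y : (forall k, reflected_step x k = y + 1 - k%:Z) ->
  mean_bailouts x = shortfall x + v * next_mean mean_bailouts y.
Proof. exact: (rvalue_step shortfall_bound v_bound reflected_step_bound). Qed.

Lemma mean_bailouts_harmonic x : 0 <= x <= b%:Z -> harmonic v mean_bailouts x.
Proof.
move=> xb; rewrite /harmonic (@mean_bailouts_step x x); last first.
  by move=> k; rewrite /reflected_step /injection /dividend; lia.
by rewrite shortfall_nonneg ?add0r //; lia.
Qed.

(** The deficit is paid at once, and the process continues from 0. *)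
Lemma mean_bailouts_le0 x : x <= 0 -> mean_bailouts x = mean_bailouts 0 - x%:~R.
Proof.
move=> x0; rewrite (@mean_bailouts_step x 0); last first.
  by move=> k; rewrite /reflected_step /injection /dividend; lia.
rewrite shortfall_le0 // addrC; congr (_ - _).
by rewrite -[LHS]/(v * _) -(mean_bailouts_harmonic (x := 0)) //; lia.
Qed.

(** The excess over [b] is paid out at once, and no capital is injected. *)
Lemma mean_bailouts_ge x : b%:Z <= x -> mean_bailouts x = mean_bailouts b%:Z.
Proof.
move=> bx; rewrite [RHS]mean_bailouts_harmonic; last by lia.
rewrite (@mean_bailouts_step x b%:Z); last first.
  by move=> k; rewrite /reflected_step /injection /dividend; lia.
by rewrite shortfall_nonneg ?add0r //; lia.
Qed.

(** The range [x <= b + 1] goes one step beyond the barrier: harmonicity at [b]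
    is used there, and the value at [b + 1] still belongs to the reflected
    process. *)
Lemma mean_bailouts_scale x : x <= b.+1%:Z ->
  mean_bailouts x + Z1v x = mean_bailouts 0 * Zv x.
Proof.
have intV := mean_bailouts_next_integrable; have intZ := Z_next_integrable.
have intZ1 := Z1_next_integrable.
apply: (harmonic_unique (f := fun y => mean_bailouts y + Z1v y)
  (g := fun y => mean_bailouts 0 * Zv y) v_gt0) => //.
- exact: next_integrableD.
- exact: next_integrableZ.
- by move=> y y0; rewrite mean_bailouts_le0 // Z1_le0 // Z_le0 // subrK mulr1.
- move=> y yb; apply: harmonicD => //.
    by apply: mean_bailouts_harmonic; lia.
  by apply: Z1_harmonic; lia.
- by move=> y yb; apply: harmonicZ => //; apply: Z_harmonic; lia.
Qed.

(** Difference of [mean_bailouts_scale] at [b + 1] and at [b], where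
    [mean_bailouts] takes the same value. *)
Lemma mean_bailouts0 : mean_bailouts 0 = fwd_diff Z1v b / fwd_diff Zv b.
Proof.
have dZ := Z_fwd_diff_gt0 b; apply: (mulIf (lt0r_neq0 dZ)).
rewrite divfK ?lt0r_neq0 // /fwd_diff mulrBr -!mean_bailouts_scale //; last by lia.
rewrite (@mean_bailouts_ge b.+1%:Z); last by lia.
by rewrite opprD addrACA subrr add0r.
Qed.

End Reflected.

End Bound.
End Harmonic.

Theorem mainTheorem6 (R : realType) (d : measure_display)
    (T : measurableType d) (P : probability T R)
    (p : nat -> R) (C : nat -> {RV P >-> nat})
    (hp : is_pmf p) (hp0 : 0 < p 0%N)
    (hC : iid_claims p C)
    (hEC : ('E_P[fun t => (C 0%N t)%:R] < +oo)%E)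
    (v : R) (hv : 0 < v < 1) (b : nat) (x : int) :
  V_B P C v b x =
  if (x <= b%:Z)%R then
    (Z P p C v x *
       (fwd_diff (Z1 P p C v) b / fwd_diff (Z P p C v) b)
     - Z1 P p C v x)%:E
  else V_B P C v b b%:Z.
Proof.
case: hC => indC lawC.
have mC i : measurable_fun setT (C i) by exact: measurable_funPT.
have intC : P.-integrable setT (fun t => (C 0%N t)%:R%:E).
  apply/integrableP; split.
    exact: (measurable_claim_EFin mC (fun k => k%:R) 0).
  under eq_integral do rewrite gee0_abs ?lee_fin //.
  by move: hEC; rewrite unlock.
rewrite !(V_BE mC indC lawC hp0 intC hv); case: ifP => [xb|/negbT xb]; congr EFin.
  rewrite -(mean_bailouts0 mC indC lawC hp0 intC hv) mulrC.
  by rewrite -(mean_bailouts_scale mC indC lawC hp0 intC hv) ?addrK //; lia.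
by apply: mean_bailouts_ge => //; lia.
Qed.
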